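(* Let $n\ge 1$ and let $M\in \mathrm{COP}_n\setminus \mathcal K_n^{(0)}$. Then the $(n+1)\times(n+1)$ matrix obtained from $M$ by adding a zero row and a zero column satisfies $$\begin{pmatrix} M & 0\\ 0 & 0\end{pmatrix}\in \mathrm{COP}_{n+1}\setminus \bigcup_{r\in\mathbb N}\mathcal K_{n+1}^{(r)}.$$
   Context: Let $\mathcal S^n$ be the space of real symmetric $n\times n$ matrices and $\mathbb N=\{0,1,2,\dots\}$. For $x\in\mathbb R^n$ put $x^{\circ 2}=(x_1^2,\dots,x_n^2)$. The copositive cone is $\mathrm{COP}_n=\{M\in\mathcal S^n: (x^{\circ 2})^TMx^{\circ 2}\ge 0 \text{ for all } x\in\mathbb R^n\}$. Let $\Sigma$ denote the set of finite sums of squares of real polynomials (in the relevant variables). For $r\in\mathbb N$, $\mathcal K_n^{(r)}=\{M\in\mathcal S^n: (\sum_{i=1}^n x_i^2)^r\,(x^{\circ 2})^TMx^{\circ 2}\in\Sigma\}$. *)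

(* Defs.v *)
From mathcomp Require Import all_boot all_order all_algebra.
From mathcomp Require Import reals.
From mathcomp Require Import mpoly.

Set Implicit Arguments.
Unset Strict Implicit.
Unset Printing Implicit Defensive.

Import Order.TTheory GRing.Theory Num.Theory.
Local Open Scope ring_scope.

Definition sqvec (A : comNzRingType) (n : nat) (x : 'cV[A]_n) : 'cV[A]_n :=
  \col_i x i 0 ^+ 2.

(* The quartic form (x^{o2})^T M x^{o2}. The scalars A are arbitrary so that
   the same expression serves both for points of R^n and for the vector of
   indeterminates of {mpoly R[n]}. *)
Definition quartic (A : comNzRingType) (n : nat) (M : 'M[A]_n) (x : 'cV[A]_n) : A :=
  ((sqvec x)^T *m M *m sqvec x) 0 0.

Definition quartic_poly (R : realType) (n : nat) (M : 'M[R]_n) : {mpoly R[n]} :=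
  quartic (map_mx (@mpolyC n R) M) (\col_i 'X_i).

Definition symmetric_mx (R : realType) (n : nat) (M : 'M[R]_n) : Prop :=
  M^T = M.

Definition is_sos (R : realType) (n : nat) (p : {mpoly R[n]}) : Prop :=
  exists s : seq {mpoly R[n]}, p = \sum_(q <- s) q ^+ 2.

Definition COP (R : realType) (n : nat) (M : 'M[R]_n) : Prop :=
  symmetric_mx M /\ forall x : 'cV[R]_n, 0 <= quartic M x.

Definition Kcone (R : realType) (n r : nat) (M : 'M[R]_n) : Prop :=
  symmetric_mx M /\
  is_sos ((\sum_(i < n) 'X_i ^+ 2) ^+ r * quartic_poly M).

(* Main.v *)
(** Bordering M by zeros leaves its quartic form q(x) unchanged. If
    (|x|^2 + y^2)^r q(x) is a sum of squares of polynomials q_k, view both sides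
    as polynomials in y over R[x]. Since a sum of squares of polynomials over
    the reals vanishes only trivially, the leading y-terms of the q_k cannot
    cancel, so each q_k has y-degree at most r. Comparing the coefficients of
    y^(2r) writes q as the sum of the squares of the y^r-coefficients of the
    q_k, which contradicts that M is not in K^(0). *)

Require Import Defs.
From HB Require Import structures.
From mathcomp Require Import all_boot all_order all_algebra.
From mathcomp Require Import reals.
From mathcomp Require Import ssrcomplements mpoly.

Set Implicit Arguments.
Unset Strict Implicit.
Unset Printing Implicit Defensive.

Import Order.TTheory GRing.Theory Num.Theory.
Local Open Scope ring_scope.

Definition formally_real (A : nzRingType) : Prop :=
  forall s : seq A, \sum_(a <- s) a ^+ 2 = 0 -> {in s, forall a, a = 0}.

Lemma formally_real_realDomain (R : realDomainType) : formally_real R.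
Proof.
move=> s /eqP; rewrite psumr_eq0; last by move=> a _; exact: sqr_ge0.
by move=> /allP s0 a /s0; rewrite sqrf_eq0 => /eqP.
Qed.

Lemma formally_real_mpoly (R : nzRingType) (n : nat) :
  formally_real R -> formally_real {mpoly R[n]}.
Proof.
(* Compare coefficients at twice the largest leading monomial. *)
move=> frR s s0.
pose m : 'X_{1..n} := (\join_(a <- s) mlead a)%O.
have le_m a : a \in s -> (mlead a <= m)%O by move=> ?; exact: joins_sup_seq.
have m0 a : a \in s -> a@_m = 0.
  move=> sa; apply: (frR [seq a@_m | a <- s]); last exact: map_f.
  rewrite big_map -[RHS](mcoeff0 _ (m + m)%MM) -s0 raddf_sum /=.
  by apply: eq_big_seq => b /le_m lem; rewrite !expr2 mleadcMW.
(* The monomial order is total, so the join over the nonempty [s] is attained, say by [b]. By [m0],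
   the leading coefficient of [b] vanishes, hence [b] is zero and [m] is the least monomial. Every
   [a] in [s] is then constant, and [m0] kills that constant. *)
move=> a sa; have [b sb mE] : exists2 b, b \in s & m = mlead b.
  rewrite /m; case: bigjoinP; first exact: le_total.
    by case: s sa {s0 le_m m0 m}.
  by move=> b; exists b.
have m_eq0 : m = 0%MM.
  have /eqP := m0 b sb; rewrite mE mleadc_eq0 => /eqP ->; exact: mlead0.
apply/eqP; rewrite -mleadc_eq0 (_ : mlead a = m) ?m0 //.
by apply/eqP; rewrite eq_le le_m // m_eq0 le0x.
Qed.

(** Of two indices with sum [d + d], one exceeds [d] unless both equal [d]. *)
Lemma coefM_top (A : nzRingType) (d : nat) (p q : {poly A}) :
  (size p <= d.+1)%N -> (size q <= d.+1)%N -> (p * q)`_(d + d) = p`_d * q`_d.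
Proof.
move=> sp sq; rewrite coefM.
have ltd : (d < (d + d).+1)%N by rewrite ltnS leq_addr.
rewrite (bigD1 (Ordinal ltd)) //= addnK big1 ?addr0 // => i neq_id.
have [ltid|ltdi|eq_id] := ltngtP (i : nat) d.
- by rewrite [q`__]nth_default ?mulr0 // (leq_trans sq) // ltn_subRL ltn_add2r.
- by rewrite nth_default ?mul0r // (leq_trans sp).
- by rewrite -val_eqE /= eq_id eqxx in neq_id.
Qed.

Lemma size_sum_sqr (A : nzRingType) (s : seq {poly A}) (r : nat) :
  formally_real A -> (size (\sum_(p <- s) p ^+ 2)%R <= (r + r).+1)%N ->
  {in s, forall p : {poly A}, (size p <= r.+1)%N}.
Proof.
move=> frA size_sum.
(* The bound goes down from the largest size one degree at a time. For a degree [d > r], the squares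
   of the coefficients at [d] add up to the coefficient of the sum at [d + d], which lies beyond its
   size; formal reality makes each of them zero. *)
suff descent k : {in s, forall p : {poly A}, (size p <= r.+1 + k)%N} ->
    {in s, forall p : {poly A}, (size p <= r.+1)%N}.
  apply: (descent (\max_(p <- s) size p)%N) => p sp.
  by apply: leq_trans (leq_addl _ _);
  exact: leq_bigmax_seq.
elim: k => [|k IHk] size_s; first by move=> p /size_s; rewrite addn0.
apply: IHk => p sp; set d := (r.+1 + k)%N.
have size_d q : q \in s -> (size q <= d.+1)%N by move/size_s; rewrite addnS.
suff pd0 : p`_d = 0.
  apply/leq_sizeP => j; rewrite leq_eqVlt => /predU1P[<- //|ltdj].
  by rewrite nth_default // (leq_trans (size_d _ sp)).
apply: (frA [seq (q : {poly A})`_d | q <- s]); last exact: map_f.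
rewrite big_map -[RHS](@nth_default _ 0 _ (d + d) (leq_trans size_sum _)).
  rewrite coef_sum; apply: eq_big_seq => q sq.
  by rewrite !expr2 coefM_top ?size_d.
by rewrite -addSn leq_add ?leq_addr // ltnW ?leq_addr.
Qed.

Lemma quartic_map (A B : comNzRingType) (f : {rmorphism A -> B}) (n : nat)
    (M : 'M[A]_n) (x : 'cV[A]_n) :
  f (quartic M x) = quartic (map_mx f M) (map_mx f x).
Proof.
rewrite /quartic (_ : sqvec (map_mx f x) = map_mx f (sqvec x)).
  by rewrite map_trmx -!map_mxM [RHS]mxE.
by apply/colP => i; rewrite !mxE rmorphXn.
Qed.

Lemma quartic_block0 (A : comNzRingType) (m n : nat) (M : 'M[A]_m)
    (x : 'cV[A]_(m + n)) :
  quartic (block_mx M 0 0 0) x = quartic M (usubmx x).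
Proof.
rewrite /quartic (_ : sqvec x = col_mx (sqvec (usubmx x)) (sqvec (dsubmx x))).
  by rewrite tr_col_mx mul_row_block !mulmx0 !addr0 mul_row_col mul0mx addr0.
apply/colP => i; rewrite !mxE; case: splitP => j ij; rewrite !mxE;
  by congr (x _ _ ^+ 2); exact: val_inj.
Qed.

Definition last_var_point (R : comNzRingType) (n : nat) (i : 'I_(n + 1)) :
    {poly {mpoly R[n]}} :=
  match split i with inl j => ('X_j)%:P | inr _ => 'X end.

(** One direction of the identification of R[x, y] with R[x][y], written as an evaluation so that it
    inherits the ring morphism structure of [mmap]. *)
Definition to_last_var (R : comNzRingType) (n : nat) :
    {mpoly R[n + 1]} -> {poly {mpoly R[n]}} :=
  mmap (polyC \o @mpolyC n R) (@last_var_point R n).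

HB.instance Definition _ (R : comNzRingType) (n : nat) :=
  GRing.RMorphism.on (@to_last_var R n).

Theorem mainTheorem2 (R : realType) (n : nat) (hn : (1 <= n)%N) (M : 'M[R]_n)
    (hCOP : COP M) (hK : ~ Kcone 0 M) :
  let N : 'M[R]_(n + 1) := block_mx M 0 0 0 in
  COP N /\ ~ (exists r : nat, Kcone r N).
Proof.
move=> N; case: hCOP => symM M_ge0; split.
  split=> [|x]; last by rewrite /N quartic_block0.
  by rewrite /symmetric_mx /N tr_block_mx symM !trmx0.
case=> r [_ [s sos_s]]; apply: hK; split=> //.
pose f : {rmorphism {mpoly R[n + 1]} -> {poly {mpoly R[n]}}} := @to_last_var R n.
have fX i : f 'X_i = last_var_point R i.
  by rewrite /f /= /to_last_var mmapX mmap1U.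
have fC c : f c%:MP = (c%:MP)%:P by rewrite /f /= /to_last_var mmapC.
have fXl (i : 'I_n) : f 'X_(lshift 1 i) = ('X_i)%:P.
  by rewrite fX /last_var_point (unsplitK (inl i)).
have fXr (i : 'I_1) : f 'X_(rshift n i) = 'X.
  by rewrite fX /last_var_point (unsplitK (inr i)).
set q := quartic_poly M; set c : {mpoly R[n]} := \sum_(i < n) 'X_i ^+ 2.
have fq : f (quartic_poly N) = q%:P.
  (* [quartic_map] pushes both [f] and [polyC] inside the form, leaving them to be compared on the
     entries of [M] and on the first [n] indeterminates. *)
  rewrite /q /quartic_poly /N map_block_mx !map_mx0 quartic_block0 !quartic_map.
  rewrite -!map_mx_comp; congr quartic.
    by apply/matrixP => i j; rewrite !mxE /= fC.
  by apply/colP => i; rewrite !mxE /= fXl.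
have fS : f (\sum_(i < n + 1) 'X_i ^+ 2) = 'X^2 + c%:P.
  rewrite big_split_ord big_ord1 /= rmorphD rmorphXn /= fXr addrC !rmorph_sum.
  by congr (_ + _); apply: eq_bigr => i _; rewrite !rmorphXn /= fXl.
set base : {poly {mpoly R[n]}} := 'X^2 + c%:P in fS.
(* Whatever [c] is, [base] is monic of degree 2 in y, so its power [r] has top term y^(2r) with
   coefficient 1. *)
have size_base : size base = 3 by rewrite size_XnaddC.
have monic_base : base \is monic by rewrite monicXnaddC.
have size_base_r : (size (base ^+ r)).-1 = (r + r)%N.
  by rewrite size_exp size_base mul2n addnn.
pose t : seq {poly {mpoly R[n]}} := map f s.
have fs : base ^+ r * q%:P = \sum_(p <- t) p ^+ 2.
  rewrite -fS -fq -rmorphXn -rmorphM sos_s rmorph_sum big_map.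
  by apply: eq_bigr => p _; rewrite rmorphXn.
exists [seq (p : {poly _})`_r | p <- t].
have size_fs : {in t, forall p : {poly {mpoly R[n]}}, (size p <= r.+1)%N}.
  apply: size_sum_sqr.
    exact/formally_real_mpoly/formally_real_realDomain.
  (* The factor [q] is constant in y, so it cannot raise the degree above [r + r]. *)
  by rewrite -fs mulrC mul_polyC -size_base_r
    (leq_trans (size_scale_leq _ _)) ?leqSpred.
have topE : (base ^+ r * q%:P)`_(r + r) = q.
  by rewrite coefMC -size_base_r -lead_coefE
    (monicP (monic_exp _ monic_base)) mul1r.
(* By [size_fs], [r] is a top degree for every [p], so the coefficient of [p ^+ 2] at [r + r] is the
   square of the one of [p] at [r]. *)
rewrite expr0 mul1r -/q -topE fs coef_sum [RHS]big_map.
by apply: eq_big_seq => p /size_fs sp; rewrite !expr2 coefM_top.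
Qed.
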